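(* Möbius transformations preserve the cycles in the upper half plane, in each of the elliptic ($\sigma=-1$), parabolic ($\sigma=0$) and hyperbolic ($\sigma=1$) cases. Precisely: let $\sigma\in\{-1,0,1\}$, let $g\in SL_2(\mathbb{R})$ act on $\mathbb{R}^a=\{ue_1+ve_2 : (u,v)\in\mathbb{R}^2\}$ by the Möbius transformation $w\mapsto g\cdot w$ of type $\sigma$, and let $S\subset\mathbb{R}^a$ be a cycle of type $\sigma$. Then there is a cycle $S'\subset\mathbb{R}^a$ of the same type $\sigma$ such that $g$ maps $S$ to $S'$, in the sense that for every point $w=ue_1+ve_2$ with $v>0$ at which $g\cdot w$ is defined, $w\in S$ if and only if $g\cdot w\in S'$. That is: (e) for $\sigma=-1$, Möbius transformations map circles (or straight lines) to circles (or straight lines); (p) for $\sigma=0$, Möbius transformations map parabolas with a vertical axis of symmetry (or straight lines) to parabolas with a vertical axis of symmetry (or straight lines); (h) for $\sigma=1$, Möbius transformations map equilateral hyperbolas with a vertical axis of symmetry (or straight lines) to equilateral hyperbolas with a vertical axis of symmetry (or straight lines).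
   Context: For $\sigma\in\{-1,0,1\}$ let $\mathcal{C}\ell(a)$ be the associative unital real algebra with linear basis $1,e_1,e_2,e_1e_2$ and multiplication determined by $e_1^2=-1$, $e_2^2=\sigma$, $e_1e_2=-e_2e_1$. The cases $\sigma=-1,0,1$ are called elliptic (e), parabolic (p) and hyperbolic (h). The plane $\mathbb{R}^2$ is identified with the set of vectors $\mathbb{R}^a=\{ue_1+ve_2 : (u,v)\in\mathbb{R}^2\}\subset\mathcal{C}\ell(a)$; the upper half plane is $\{v>0\}$, and ''vertical'' means parallel to the $v$-axis. The group $SL_2(\mathbb{R})$ of real matrices $\begin{pmatrix} a & b \\ c & d \end{pmatrix}$ with $ad-bc=1$ is realised as the matrices $\begin{pmatrix} a & -b e_1 \\ c e_1 & d \end{pmatrix}$ over $\mathcal{C}\ell(a)$. The Möbius transformation of $\mathbb{R}^a$ defined by such an element $g$ is $$g\cdot(ue_1+ve_2)=\bigl(a(ue_1+ve_2)-be_1\bigr)\bigl(c e_1(ue_1+ve_2)+d\bigr)^{-1},$$ which is defined at the points where $c e_1(ue_1+ve_2)+d$ is invertible in $\mathcal{C}\ell(a)$. A cycle of type $\sigma$ is a subset of $\mathbb{R}^a\cong\mathbb{R}^2$ that is either a straight line (any straight line), or: (e) for $\sigma=-1$, a circle (of positive radius); (p) for $\sigma=0$, a (non-degenerate) parabola with a vertical axis of symmetry; (h) for $\sigma=1$, a (non-degenerate) equilateral hyperbola, consisting of both branches, with a vertical axis of symmetry, i.e. a curve $(u-u_0)^2-(v-v_0)^2=k$ with $k\neq0$.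 Here circles, parabolas, hyperbolas and lines are those of ordinary Euclidean geometry in the coordinates $(u,v)$. *)

(* Defs.v *)
From HB Require Import structures.
From mathcomp Require Import all_boot all_order all_algebra.
From mathcomp Require Import ring lra.
From mathcomp Require Import boolp classical_sets reals.

Set Implicit Arguments.
Unset Strict Implicit.
Unset Printing Implicit Defensive.

Import Order.TTheory GRing.Theory Num.Theory.

Local Open Scope ring_scope.

Definition vec4 (R : realType) (a b c d : R) : 'rV[R]_4 :=
  \row_(i < 4) [:: a; b; c; d]`_i.

(* Coordinates are taken in the basis 1, e1, e2, e1 e2. The parameter sigma   *)
(* only selects the multiplication below.                                     *)
Definition cliff (R : realType) (sigma : R) : Type := 'rV[R]_4.

HB.instance Definition _ (R : realType) (sigma : R) :=
  GRing.Lmodule.copy (cliff sigma) 'rV[R]_4.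

Section Clifford.
Context (R : realType) (sigma : R).
Local Notation C := (cliff sigma).
Implicit Types x y z : C.

Definition cl (a b c d : R) : C := vec4 a b c d.
Definition cl0 x : R := (x : 'rV_4) 0 (inord 0).
Definition cl1 x : R := (x : 'rV_4) 0 (inord 1).
Definition cl2 x : R := (x : 'rV_4) 0 (inord 2).
Definition cl12 x : R := (x : 'rV_4) 0 (inord 3).

Lemma cl0E a b c d : cl0 (cl a b c d) = a.
Proof. by rewrite /cl0 mxE inordK. Qed.
Lemma cl1E a b c d : cl1 (cl a b c d) = b.
Proof. by rewrite /cl1 mxE inordK. Qed.
Lemma cl2E a b c d : cl2 (cl a b c d) = c.
Proof. by rewrite /cl2 mxE inordK. Qed.
Lemma cl12E a b c d : cl12 (cl a b c d) = d.
Proof. by rewrite /cl12 mxE inordK. Qed.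

Lemma cl0D x y : cl0 (x + y) = cl0 x + cl0 y. Proof. by rewrite /cl0 mxE. Qed.
Lemma cl1D x y : cl1 (x + y) = cl1 x + cl1 y. Proof. by rewrite /cl1 mxE. Qed.
Lemma cl2D x y : cl2 (x + y) = cl2 x + cl2 y. Proof. by rewrite /cl2 mxE. Qed.
Lemma cl12D x y : cl12 (x + y) = cl12 x + cl12 y.
Proof. by rewrite /cl12 mxE. Qed.
Lemma cl0Z a x : cl0 (a *: x) = a * cl0 x. Proof. by rewrite /cl0 mxE. Qed.
Lemma cl1Z a x : cl1 (a *: x) = a * cl1 x. Proof. by rewrite /cl1 mxE. Qed.
Lemma cl2Z a x : cl2 (a *: x) = a * cl2 x. Proof. by rewrite /cl2 mxE. Qed.
Lemma cl12Z a x : cl12 (a *: x) = a * cl12 x. Proof. by rewrite /cl12 mxE. Qed.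
Lemma cl0N x : cl0 (- x) = - cl0 x. Proof. by rewrite /cl0 mxE. Qed.
Lemma cl1N x : cl1 (- x) = - cl1 x. Proof. by rewrite /cl1 mxE. Qed.
Lemma cl2N x : cl2 (- x) = - cl2 x. Proof. by rewrite /cl2 mxE. Qed.
Lemma cl12N x : cl12 (- x) = - cl12 x. Proof. by rewrite /cl12 mxE. Qed.

Definition cl_linE :=
  (cl0E, cl1E, cl2E, cl12E, cl0D, cl1D, cl2D, cl12D,
   cl0Z, cl1Z, cl2Z, cl12Z, cl0N, cl1N, cl2N, cl12N).

Lemma cl_eq x y : cl0 x = cl0 y -> cl1 x = cl1 y -> cl2 x = cl2 y ->
  cl12 x = cl12 y -> x = y.
Proof.
move=> h0 h1 h2 h3; apply/rowP => i.
rewrite -(inord_val i); case: i => [[|[|[|[|i]]]] hi] //=.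
Qed.

(* From e1^2 = -1, e2^2 = sigma and e2 e1 = - e1 e2:                          *)
(* (e1 e2)^2 = sigma, e1 (e1 e2) = - e2 = - (e1 e2) e1 and                    *)
(* (e1 e2) e2 = sigma e1 = - e2 (e1 e2).                                      *)
Definition cl_mul x y : C :=
  cl (cl0 x * cl0 y - cl1 x * cl1 y + sigma * (cl2 x * cl2 y)
        + sigma * (cl12 x * cl12 y))
     (cl0 x * cl1 y + cl1 x * cl0 y - sigma * (cl2 x * cl12 y)
        + sigma * (cl12 x * cl2 y))
     (cl0 x * cl2 y + cl2 x * cl0 y - cl1 x * cl12 y + cl12 x * cl1 y)
     (cl0 x * cl12 y + cl12 x * cl0 y + cl1 x * cl2 y - cl2 x * cl1 y).

Definition cl_one : C := cl 1 0 0 0.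

Lemma cl_mulA : associative cl_mul.
Proof. by move=> x y z; apply: cl_eq; rewrite !cl_linE; ring. Qed.
Lemma cl_mul1x : left_id cl_one cl_mul.
Proof. by move=> x; apply: cl_eq; rewrite !cl_linE; ring. Qed.
Lemma cl_mulx1 : right_id cl_one cl_mul.
Proof. by move=> x; apply: cl_eq; rewrite !cl_linE; ring. Qed.
Lemma cl_mulDl : left_distributive cl_mul +%R.
Proof. by move=> x y z; apply: cl_eq; rewrite !cl_linE; ring. Qed.
Lemma cl_mulDr : right_distributive cl_mul +%R.
Proof. by move=> x y z; apply: cl_eq; rewrite !cl_linE; ring. Qed.
Lemma cl_one_neq0 : cl_one != 0.
Proof.
by apply/eqP => /(congr1 cl0)/eqP; rewrite cl0E /cl0 mxE oner_eq0.
Qed.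

HB.instance Definition _ := GRing.Zmodule_isNzRing.Build C
  cl_mulA cl_mul1x cl_mulx1 cl_mulDl cl_mulDr cl_one_neq0.

Lemma cl_scalerAl (a : R) x y : a *: (x * y) = a *: x * y.
Proof. by apply: cl_eq; rewrite !cl_linE; ring. Qed.
HB.instance Definition _ := GRing.Lmodule_isLalgebra.Build R C cl_scalerAl.

Lemma cl_scalerAr (a : R) x y : a *: (x * y) = x * (a *: y).
Proof. by apply: cl_eq; rewrite !cl_linE; ring. Qed.
HB.instance Definition _ := GRing.Lalgebra_isAlgebra.Build R C cl_scalerAr.

(* cl_norm x = x * cl_conj x is a scalar, so x is invertible iff it is        *)
(* nonzero.                                                                   *)
Definition cl_conj x : C := cl (cl0 x) (- cl1 x) (- cl2 x) (- cl12 x).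
Definition cl_norm x : R :=
  cl0 x ^+ 2 + cl1 x ^+ 2 - sigma * cl2 x ^+ 2 - sigma * cl12 x ^+ 2.
Definition cl_unit : pred C := fun x => cl_norm x != 0.
Definition cl_inv x : C :=
  if cl_norm x != 0 then (cl_norm x)^-1 *: cl_conj x else x.

Lemma cl_normM x y : cl_norm (x * y) = cl_norm x * cl_norm y.
Proof. by rewrite /cl_norm !cl_linE; ring. Qed.

Lemma cl_mul_conj x : x * cl_conj x = (cl_norm x)%:A.
Proof. by apply: cl_eq; rewrite !cl_linE /cl_norm; ring. Qed.
Lemma cl_conj_mul x : cl_conj x * x = (cl_norm x)%:A.
Proof. by apply: cl_eq; rewrite !cl_linE /cl_norm; ring. Qed.

Lemma cl_mulVx : {in cl_unit, left_inverse 1 cl_inv *%R}.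
Proof.
move=> x hx; have {}hx : cl_norm x != 0 := hx; rewrite /cl_inv hx.
by rewrite -scalerAl cl_conj_mul scalerA mulVf // scale1r.
Qed.
Lemma cl_mulxV : {in cl_unit, right_inverse 1 cl_inv *%R}.
Proof.
move=> x hx; have {}hx : cl_norm x != 0 := hx; rewrite /cl_inv hx.
by rewrite -scalerAr cl_mul_conj scalerA mulVf // scale1r.
Qed.
Lemma cl_unitP x y : y * x = 1 /\ x * y = 1 -> cl_unit x.
Proof.
move=> [h _]; apply/eqP => hx.
have := cl_normM y x; rewrite h hx mulr0 /cl_norm !cl_linE.
by rewrite expr1n expr0n /= !(mulr0, addr0, subr0) => /eqP; rewrite oner_eq0.
Qed.
Lemma cl_invr_out : {in [predC cl_unit], cl_inv =1 id}.
Proof. by move=> x hx; rewrite /cl_inv ifN. Qed.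

HB.instance Definition _ := GRing.NzRing_hasMulInverse.Build C
  cl_mulVx cl_mulxV cl_unitP cl_invr_out.

Definition e1 : C := cl 0 1 0 0.
Definition e2 : C := cl 0 0 1 0.

Lemma e1_sqr : e1 * e1 = - 1.
Proof. by apply: cl_eq; rewrite !cl_linE; ring. Qed.
Lemma e2_sqr : e2 * e2 = sigma%:A.
Proof. by apply: cl_eq; rewrite !cl_linE; ring. Qed.
Lemma e1e2_anti : e1 * e2 = - (e2 * e1).
Proof. by apply: cl_eq; rewrite !cl_linE; ring. Qed.
Lemma cl_basis x :
  x = (cl0 x)%:A + cl1 x *: e1 + cl2 x *: e2 + cl12 x *: (e1 * e2).
Proof. by apply: cl_eq; rewrite !cl_linE; ring. Qed.

Definition vect (p : R * R) : C := p.1 *: e1 + p.2 *: e2.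

(* g = (a b; c d) is realised over C as (a, - b e1; c e1, d), whence          *)
(* g . w = (a w - b e1) (c e1 w + d)^-1. The ring inverse is the identity on  *)
(* non-units, so mobius is meaningful only where mobius_defined holds.        *)
Definition mobius_den (g : 'M[R]_2) (w : C) : C :=
  g 1 0 *: (e1 * w) + (g 1 1)%:A.

Definition mobius_defined (g : 'M[R]_2) (w : C) : bool :=
  mobius_den g w \is a GRing.unit.

Definition mobius (g : 'M[R]_2) (w : C) : C :=
  (g 0 0 *: w - g 0 1 *: e1) * (mobius_den g w)^-1.

Lemma mobius_vect (g : 'M[R]_2) (p : R * R) : mobius_defined g (vect p) ->
  exists q : R * R, mobius g (vect p) = vect q.
Proof.
rewrite /mobius_defined /mobius => h.
have -> : (mobius_den g (vect p))^-1 = cl_inv (mobius_den g (vect p)) by [].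
have {}h : cl_norm (mobius_den g (vect p)) != 0 by [].
rewrite /cl_inv h -scalerAr.
set k := (cl_norm _)^-1; set z := (_ * _).
exists (k * cl1 z, k * cl2 z).
by apply: cl_eq; rewrite /z /vect /mobius_den !cl_linE /=; ring.
Qed.

Local Open Scope classical_set_scope.

Definition line (L : set (R * R)) : Prop :=
  exists a b c : R, (a, b) != (0, 0) /\
    L = [set p | a * p.1 + b * p.2 + c = 0].

Definition circle (L : set (R * R)) : Prop :=
  exists u0 v0 r : R, 0 < r /\
    L = [set p | (p.1 - u0) ^+ 2 + (p.2 - v0) ^+ 2 = r ^+ 2].

Definition vertical_parabola (L : set (R * R)) : Prop :=
  exists u0 v0 k : R, k != 0 /\
    L = [set p | p.2 - v0 = k * (p.1 - u0) ^+ 2].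

Definition vertical_equilateral_hyperbola (L : set (R * R)) : Prop :=
  exists u0 v0 k : R, k != 0 /\
    L = [set p | (p.1 - u0) ^+ 2 - (p.2 - v0) ^+ 2 = k].

Definition cycle_of_type (S : set C) : Prop :=
  exists2 L : set (R * R), S = vect @` L &
    [\/ line L,
        sigma = -1 /\ circle L,
        sigma = 0 /\ vertical_parabola L |
        sigma = 1 /\ vertical_equilateral_hyperbola L].

End Clifford.

Arguments cl {R} sigma a b c d.
Arguments e1 {R} sigma.
Arguments e2 {R} sigma.
Arguments vect {R} sigma p.
Arguments mobius_den {R} sigma g w.
Arguments mobius_defined {R} sigma g w.
Arguments mobius {R} sigma g w.
Arguments cycle_of_type {R} sigma S.

(* Main.v *)
Require Import Defs.
From mathcomp Require Import all_boot all_order all_algebra.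
From mathcomp Require Import ring lra.
From mathcomp Require Import classical_sets reals.

Import Order.TTheory GRing.Theory Num.Theory.

Local Open Scope ring_scope.

(** Write N(u, v) = u^2 - sigma v^2. All cycles of type sigma are loci
    K N(u, v) + L u + n v + M = 0, and Moebius transformations act on these
    loci: if Delta(p) is the norm of the denominator c e1 w + d, then Delta(p)
    times the equation with coefficients (K', L', n', M') taken at the image of
    p is an equation of the same shape at p, whose coefficients are linear in
    (K', L', n', M') ([locus_mobius]). Inverting that linear map gives the
    image locus.

    The image locus need not be a genuine cycle: it could be a point, empty, or
    a pair of lines. Two invariants of the action control this, n and the
    discriminant L^2 - sigma n^2 - 4 K M. A locus is a circle or a line when
    sigma = -1 and the discriminant is positive, a parabola or a line when
    sigma = 0 and n is nonzero, and a hyperbola or a line when sigma = 1 and the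
    discriminant is nonzero ([cycle_locus]).

    The only cycles that fail this condition ([cycle_locus_or_null_line]) are
    the lines u + eps v = s with eps^2 = sigma, that is, vertical lines when
    sigma = 0 and the lines of slope 1 or -1 when sigma = 1; their image locus
    may be a pair of lines. For them, N factors
    as (u + eps v) (u - eps v), and u + eps v is transformed on its own by the
    real homography x |-> (a x - b) / (d - c x) ([null_form_mobius]), so their
    images lie on lines of the same kind ([null_line_mobius]). *)

(** * The transformation in coordinates *)

Lemma vect_inj (R : realType) (sigma : R) : injective (vect sigma).
Proof.
move=> [u v] [u' v'] h.
have := congr1 (@cl1 R sigma) h; have := congr1 (@cl2 R sigma) h.
by rewrite /vect !cl_linE /= !(mulr0, mulr1, addr0, add0r) => -> ->.
Qed.

Lemma vect_imageE (R : realType) (sigma : R) (L : set (R * R)) (p : R * R) :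
  (image L (vect sigma)) (vect sigma p) <-> L p.
Proof. by split=> [[q Lq /vect_inj <-] //|Lp]; exists p. Qed.

Lemma mobius_det (R : realType) (g : 'M[R]_2) : \det g = 1 ->
  g 0 0 * g 1 1 - g 0 1 * g 1 0 = 1.
Proof.
rewrite (expand_det_row _ 0) !big_ord_recl big_ord0 /cofactor !det_mx11 !mxE.
have -> : lift 0 0 = 1 :> 'I_2 by apply: val_inj.
have -> : lift 1 0 = 0 :> 'I_2 by apply: val_inj.
by rewrite /= => <-; ring.
Qed.

(** The norm of the denominator c e1 w + d at w = u e1 + v e2. *)
Definition mobius_norm {R : realType} (sigma : R) (g : 'M[R]_2) (p : R * R) : R :=
  (g 1 1 - g 1 0 * p.1) ^+ 2 - sigma * (g 1 0 * p.2) ^+ 2.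

Definition mobius_pt {R : realType} (sigma : R) (g : 'M[R]_2) (p : R * R) :
    R * R :=
  (((g 0 0 * p.1 - g 0 1) * (g 1 1 - g 1 0 * p.1)
     + sigma * g 0 0 * g 1 0 * p.2 ^+ 2) / mobius_norm sigma g p,
   p.2 / mobius_norm sigma g p).

Lemma mobius_norm_neq0 (R : realType) (sigma : R) (g : 'M[R]_2) (p : R * R) :
  mobius_defined sigma g (vect sigma p) -> mobius_norm sigma g p != 0.
Proof.
move=> h; have {h} : cl_norm (mobius_den sigma g (vect sigma p)) != 0 := h.
congr (_ != 0); rewrite /cl_norm /mobius_den /mobius_norm /vect !cl_linE /=.
ring.
Qed.

Lemma mobius_ptE (R : realType) (sigma : R) (g : 'M[R]_2) (p : R * R) :
  \det g = 1 -> mobius_defined sigma g (vect sigma p) ->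
  mobius sigma g (vect sigma p) = vect sigma (mobius_pt sigma g p).
Proof.
move=> /mobius_det hg hdef; rewrite /mobius.
have -> : (mobius_den sigma g (vect sigma p))^-1
        = cl_inv (mobius_den sigma g (vect sigma p)) by [].
have h : cl_norm (mobius_den sigma g (vect sigma p)) != 0 := hdef.
have normE : cl_norm (mobius_den sigma g (vect sigma p))
             = mobius_norm sigma g p.
  by rewrite /cl_norm /mobius_den /mobius_norm /vect !cl_linE /=; ring.
rewrite /cl_inv h normE -scalerAr /mobius_pt.
(* The second coordinate comes out with the factor det g. *)
rewrite -[p.2 / _]mul1r -hg.
by apply: cl_eq; rewrite /vect /mobius_den !cl_linE /=; ring.
Qed.

(** * The common equation of all cycles *)

Definition locus_form {R : realType} (sigma K L n M : R) (p : R * R) : R :=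
  K * (p.1 ^+ 2 - sigma * p.2 ^+ 2) + L * p.1 + n * p.2 + M.

Definition locus {R : realType} (sigma K L n M : R) : set (R * R) :=
  [set p | locus_form sigma K L n M p = 0]%classic.

Definition discriminant {R : realType} (sigma K L n M : R) : R :=
  L ^+ 2 - sigma * n ^+ 2 - 4 * K * M.

(** Excludes points, empty sets and pairs of lines. When sigma = 0 the
    discriminant is the one of the quadratic K u^2 + L u + M, which says
    nothing about the shape of the locus, so n takes its place. *)
Definition nondegenerate {R : realType} (sigma K L n M : R) : Prop :=
  [\/ sigma = -1 /\ 0 < discriminant sigma K L n M,
      sigma = 0 /\ n != 0 |
      sigma = 1 /\ discriminant sigma K L n M != 0].

(** The new coefficients are obtained from (K, L, M) by the inverse of the
    symmetric square of g. *)
Lemma locus_form_mobius (R : realType) (sigma : R) (g : 'M[R]_2)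
    (K L n M : R) (p : R * R) :
  \det g = 1 -> mobius_norm sigma g p != 0 ->
  let a := g 0 0 in let b := g 0 1 in let c := g 1 0 in let d := g 1 1 in
  mobius_norm sigma g p *
    locus_form sigma (d ^+ 2 * K + c * d * L + c ^+ 2 * M)
      (2 * b * d * K + (a * d + b * c) * L + 2 * a * c * M) n
      (b ^+ 2 * K + a * b * L + a ^+ 2 * M) (mobius_pt sigma g p)
  = locus_form sigma K L n M p.
Proof.
move=> /mobius_det dg hN a b c d.
rewrite -/a -/b -/c -/d in dg.
(* The norm is multiplicative, so at the image point N is the quotient of
   the norms of numerator and denominator. *)
have NE : (mobius_pt sigma g p).1 ^+ 2 - sigma * (mobius_pt sigma g p).2 ^+ 2
    = ((a * p.1 - b) ^+ 2 - sigma * (a * p.2) ^+ 2) / mobius_norm sigma g p.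
  rewrite /mobius_pt /= -[p.2 / _]mul1r -dg.
  move: hN; rewrite /mobius_norm -/a -/b -/c -/d => hN; field.
  exact: hN.
have D0 : mobius_norm sigma g p * (mobius_norm sigma g p)^-1 = 1.
  by rewrite mulfV.
rewrite /locus_form NE /mobius_pt /= -/a -/b -/c -/d.
set D := mobius_norm sigma g p in D0 *.
set K' := (_ + c ^+ 2 * M); set L' := (_ + 2 * a * c * M).
set M' := (_ + a ^+ 2 * M).
pose x := (a * p.1 - b) ^+ 2 - sigma * (a * p.2) ^+ 2.
pose y := (a * p.1 - b) * (d - c * p.1) + sigma * a * c * p.2 ^+ 2.
rewrite -/x -/y.
transitivity (D * D^-1 * (K' * x + L' * y + n * p.2) + M' * D); first by ring.
rewrite D0 mul1r.
transitivity ((a * d - b * c) ^+ 2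
    * (K * (p.1 ^+ 2 - sigma * p.2 ^+ 2) + L * p.1 + M) + n * p.2).
  by rewrite /K' /L' /M' /x /y /D /mobius_norm -/c -/d; ring.
by rewrite dg; ring.
Qed.

Lemma locus_mobius (R : realType) (sigma : R) (g : 'M[R]_2) (K L n M : R) :
  \det g = 1 -> nondegenerate sigma K L n M ->
  exists K' L' n' M' : R, nondegenerate sigma K' L' n' M' /\
    forall p, mobius_norm sigma g p != 0 ->
      locus sigma K L n M p <-> locus sigma K' L' n' M' (mobius_pt sigma g p).
Proof.
move=> hg hnd; have dg := mobius_det _ _ hg.
pose a := g 0 0; pose b := g 0 1; pose c := g 1 0; pose d := g 1 1.
rewrite -/a -/b -/c -/d in dg.
pose K' := d ^+ 2 * K + c * d * L + c ^+ 2 * M.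
pose L' := 2 * b * d * K + (a * d + b * c) * L + 2 * a * c * M.
pose M' := b ^+ 2 * K + a * b * L + a ^+ 2 * M.
exists K', L', n, M'; split.
  have discE : discriminant sigma K' L' n M' = discriminant sigma K L n M.
    transitivity ((a * d - b * c) ^+ 2 * (L ^+ 2 - 4 * K * M)
                  - sigma * n ^+ 2).
      by rewrite /discriminant /K' /L' /M'; ring.
    by rewrite dg /discriminant; ring.
  by rewrite /nondegenerate discE.
move=> p hN; rewrite /locus /= -(locus_form_mobius _ _ _ K L n M p hg hN) /=.
split=> [/eqP|->]; last by rewrite mulr0.
by rewrite mulf_eq0 (negPf hN) /= => /eqP.
Qed.

(** Completing squares; the locus is a line when K = 0. *)
Lemma cycle_locus (R : realType) (sigma K L n M : R) :
  nondegenerate sigma K L n M ->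
  cycle_of_type sigma (image (locus sigma K L n M) (vect sigma)).
Proof.
move=> hnd; exists (locus sigma K L n M) => //.
have [K0|K0] := eqVneq K 0.
  apply: Or41; exists L, n, M; split.
    apply/eqP => -[L0 n0]; move: hnd.
    have D0 : discriminant sigma K L n M = 0.
      by rewrite /discriminant K0 L0 n0; ring.
    by rewrite /nondegenerate D0 n0 ltxx eqxx => -[] [].
  by apply/seteqP; split=> p; rewrite /locus /= /locus_form K0 mul0r add0r.
have K2 : 4 * K ^+ 2 != 0 by rewrite mulf_neq0 ?pnatr_eq0 // expf_neq0.
case: hnd => -[-> hnd].
- apply: Or42; split=> //; exists (- L / (2 * K)), (- n / (2 * K)).
  exists (Num.sqrt (discriminant (-1) K L n M / (4 * K ^+ 2))).
  have hr : 0 < discriminant (-1) K L n M / (4 * K ^+ 2).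
    by rewrite divr_gt0 // mulr_gt0 // exprn_even_gt0.
  split; first by rewrite sqrtr_gt0.
  have E p : locus_form (-1) K L n M p =
      K * ((p.1 - - L / (2 * K)) ^+ 2 + (p.2 - - n / (2 * K)) ^+ 2
           - discriminant (-1) K L n M / (4 * K ^+ 2)).
    by rewrite /locus_form /discriminant; field.
  apply/seteqP; split=> p; rewrite /locus /= E sqr_sqrtr ?(ltW hr) //.
    by move/eqP; rewrite mulf_eq0 (negPf K0) subr_eq0 => /eqP.
  by move=> ->; rewrite subrr mulr0.
- apply: Or43; split=> //; exists (- L / (2 * K)).
  exists ((L ^+ 2 - 4 * K * M) / (4 * K * n)), (- K / n).
  split; first by rewrite mulf_neq0 ?invr_eq0 ?oppr_eq0.
  have E p : locus_form 0 K L n M p =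
      n * (p.2 - (L ^+ 2 - 4 * K * M) / (4 * K * n)
           - - K / n * (p.1 - - L / (2 * K)) ^+ 2).
    by rewrite /locus_form; field; apply/andP.
  apply/seteqP; split=> p; rewrite /locus /= E.
    by move/eqP; rewrite mulf_eq0 (negPf hnd) subr_eq0 => /eqP.
  by move=> ->; rewrite subrr mulr0.
apply: Or44; split=> //; exists (- L / (2 * K)), (n / (2 * K)).
exists (discriminant 1 K L n M / (4 * K ^+ 2)).
split; first by rewrite mulf_neq0 ?invr_eq0.
have E p : locus_form 1 K L n M p =
    K * ((p.1 - - L / (2 * K)) ^+ 2 - (p.2 - n / (2 * K)) ^+ 2
         - discriminant 1 K L n M / (4 * K ^+ 2)).
  by rewrite /locus_form /discriminant; field.
apply/seteqP; split=> p; rewrite /locus /= E.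
  by move/eqP; rewrite mulf_eq0 (negPf K0) subr_eq0 => /eqP.
by move=> ->; rewrite subrr mulr0.
Qed.

(** * Null lines *)

Definition null_line {R : realType} (eps s : R) : set (R * R) :=
  [set p | p.1 + eps * p.2 = s]%classic.

Lemma cycle_null_line (R : realType) (sigma eps s : R) :
  cycle_of_type sigma (image (null_line eps s) (vect sigma)).
Proof.
exists (null_line eps s) => //; apply: Or41; exists 1, eps, (- s); split.
  by apply/eqP => -[/eqP]; rewrite oner_eq0.
by apply/seteqP; split=> p; rewrite /null_line /= mul1r => h; lra.
Qed.

(** The norm of the denominator factors as (d - c x) (d - c y), where x and y
    are the values of u + eps v and u - eps v; hence d - c x is nonzero, and
    d - c y cancels from the value of u + eps v at the image. *)
Lemma null_form_mobius (R : realType) (sigma eps : R) (g : 'M[R]_2)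
    (p : R * R) :
  \det g = 1 -> eps ^+ 2 = sigma -> mobius_norm sigma g p != 0 ->
  let x := p.1 + eps * p.2 in
  g 1 1 - g 1 0 * x != 0 /\
  (mobius_pt sigma g p).1 + eps * (mobius_pt sigma g p).2
    = (g 0 0 * x - g 0 1) / (g 1 1 - g 1 0 * x).
Proof.
move=> /mobius_det hg <- hN x.
have NE : mobius_norm (eps ^+ 2) g p
    = (g 1 1 - g 1 0 * x) * (g 1 1 - g 1 0 * (p.1 - eps * p.2)).
  by rewrite /mobius_norm /x; ring.
move: (hN); rewrite NE mulf_eq0 negb_or => /andP[hx hy]; split=> //.
rewrite /mobius_pt NE /= -[p.2 / _]mul1r -hg /x; field.
by apply/andP.
Qed.

(** If the homography sends s to infinity, the transformation is undefined on
    the whole null line, and the image null line is the one at the value a / -c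
    of the homography at infinity, which is not attained at any finite x. *)
Lemma null_line_mobius (R : realType) (sigma eps s : R) (g : 'M[R]_2) :
  \det g = 1 -> eps ^+ 2 = sigma ->
  exists s' : R, forall p, mobius_norm sigma g p != 0 ->
    null_line eps s p <-> null_line eps s' (mobius_pt sigma g p).
Proof.
move=> hg heps; have dg := mobius_det _ _ hg.
have [hs|hs] := eqVneq (g 1 1 - g 1 0 * s) 0.
  have c0 : g 1 0 != 0.
    apply/eqP => c0; move: hs dg; rewrite c0 mul0r subr0 => ->.
    by rewrite !mulr0 subrr => /eqP; rewrite eq_sym oner_eq0.
  exists (- g 0 0 / g 1 0) => p hN.
  have [hx E] := null_form_mobius _ _ _ _ _ hg heps hN.
  rewrite /null_line /= E; split=> [h|/eqP].
    by move: hx; rewrite h hs eqxx.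
  rewrite eqr_div // => /eqP h; exfalso.
  by move: dg h; nra.
exists ((g 0 0 * s - g 0 1) / (g 1 1 - g 1 0 * s)) => p hN.
have [hx E] := null_form_mobius _ _ _ _ _ hg heps hN.
rewrite /null_line /= E; split=> [->//|/eqP]; rewrite eqr_div // => /eqP h.
(* Cross-multiplied, the equation is det g * (x - s) = 0. *)
apply/eqP; rewrite -subr_eq0 -[X in X == 0]mul1r -dg.
set x := p.1 + eps * p.2 in h *.
apply/eqP; transitivity ((g 0 0 * x - g 0 1) * (g 1 1 - g 1 0 * s)
  - (g 0 0 * s - g 0 1) * (g 1 1 - g 1 0 * x)); first by ring.
by rewrite h subrr.
Qed.

(** * All cycles *)

Lemma line_locus_or_null_line (R : realType) (sigma : R) (L : set (R * R)) :
  [\/ sigma = -1, sigma = 0 | sigma = 1] -> line L ->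
  (exists K l n M : R, nondegenerate sigma K l n M /\ L = locus sigma K l n M)
  \/ (exists eps s : R, eps ^+ 2 = sigma /\ L = null_line eps s).
Proof.
move=> hsigma [a [b [c [hab ->]]]].
have lineE : [set p : R * R | a * p.1 + b * p.2 + c = 0]%classic
    = locus sigma 0 a b c.
  by apply/seteqP; split=> p; rewrite /locus /= /locus_form mul0r add0r.
have nondegenerate_line : nondegenerate sigma 0 a b c ->
    exists K l n M : R, nondegenerate sigma K l n M /\
      [set p : R * R | a * p.1 + b * p.2 + c = 0]%classic = locus sigma K l n M.
  by move=> hnd; exists 0, a, b, c.
have isotropic_line : a != 0 -> b ^+ 2 = sigma * a ^+ 2 ->
    exists eps s : R, eps ^+ 2 = sigma /\
      [set p : R * R | a * p.1 + b * p.2 + c = 0]%classic = null_line eps s.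
  move=> a0 h; exists (b / a), (- c / a).
  split; first by rewrite expr_div_n h mulfK // expf_neq0.
  have E p : a * p.1 + b * p.2 + c = a * (p.1 + b / a * p.2 - - c / a).
    by field.
  apply/seteqP; split=> p; rewrite /null_line /= E.
    by move/eqP; rewrite mulf_eq0 (negPf a0) subr_eq0 => /eqP.
  by move=> ->; rewrite subrr mulr0.
case: hsigma => sE.
- left; apply: nondegenerate_line; apply: Or31; split=> //.
  rewrite /discriminant sE.
  have -> : a ^+ 2 - -1 * b ^+ 2 - 4 * 0 * c = a ^+ 2 + b ^+ 2 by ring.
  rewrite lt_def addr_ge0 ?sqr_ge0 // andbT paddr_eq0 ?sqr_ge0 //.
  by rewrite !sqrf_eq0; move: hab; rewrite xpair_eqE.
- have [b0|b0] := eqVneq b 0; last by left; apply: nondegenerate_line; apply: Or32.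
  right; apply: isotropic_line; last by rewrite sE b0; ring.
  by move: hab; rewrite xpair_eqE b0 eqxx andbT.
have [h|h] := eqVneq (b ^+ 2) (a ^+ 2).
  right; apply: isotropic_line; last by rewrite sE h mul1r.
  apply: contraNneq hab => a0; rewrite xpair_eqE a0 eqxx /=.
  by rewrite -sqrf_eq0 h a0 expr0n.
left; apply: nondegenerate_line; apply: Or33; split=> //.
rewrite /discriminant sE; apply: contra_neq h => h; lra.
Qed.

Lemma cycle_locus_or_null_line (R : realType) (sigma : R)
    (S : set (cliff sigma)) :
  [\/ sigma = -1, sigma = 0 | sigma = 1] -> cycle_of_type sigma S ->
  exists2 L : set (R * R), S = image L (vect sigma) &
  (exists K l n M : R, nondegenerate sigma K l n M /\ L = locus sigma K l n M)
  \/ (exists eps s : R, eps ^+ 2 = sigma /\ L = null_line eps s).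
Proof.
move=> hsigma [L -> hL]; exists L => //; case: hL => [hL|[sE]|[sE]|[sE]].
- exact: line_locus_or_null_line.
- move=> [u0 [v0 [r [r0 ->]]]]; left.
  exists 1, (- 2 * u0), (- 2 * v0), (u0 ^+ 2 + v0 ^+ 2 - r ^+ 2); split.
    apply: Or31; split=> //; rewrite /discriminant sE.
    set D := (X in 0 < X); have -> : D = (2 * r) ^+ 2 by rewrite /D; ring.
    by rewrite exprn_gt0 // mulr_gt0.
  apply/seteqP; split=> p; rewrite /locus /= /locus_form sE => h.
    by rewrite -h; ring.
  by apply/eqP; rewrite -subr_eq0 -h; apply/eqP; ring.
- move=> [u0 [v0 [k [k0 ->]]]]; left.
  exists k, (- 2 * k * u0), (-1), (k * u0 ^+ 2 + v0); split.
    by apply: Or32; split=> //; rewrite oppr_eq0 oner_eq0.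
  apply/seteqP; split=> p; rewrite /locus /= /locus_form sE => h.
    have -> : p.2 = k * (p.1 - u0) ^+ 2 + v0 by rewrite -h; ring.
    by ring.
  by apply/eqP; rewrite eq_sym -subr_eq0 -h; apply/eqP; ring.
move=> [u0 [v0 [k [k0 ->]]]]; left.
exists 1, (- 2 * u0), (2 * v0), (u0 ^+ 2 - v0 ^+ 2 - k); split.
  apply: Or33; split=> //; rewrite /discriminant sE.
  set D := (X in X != 0); have -> : D = 4 * k by rewrite /D; ring.
  by rewrite mulf_neq0 // pnatr_eq0.
apply/seteqP; split=> p; rewrite /locus /= /locus_form sE => h.
  by rewrite -h; ring.
by apply/eqP; rewrite -subr_eq0 -h; apply/eqP; ring.
Qed.

Theorem lemma2p5 (R : realType) (sigma : R)
  (hsigma : [\/ sigma = -1, sigma = 0 | sigma = 1])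
  (g : 'M[R]_2) (hg : \det g = 1)
  (S : set (cliff sigma)) (hS : cycle_of_type sigma S) :
  exists2 S' : set (cliff sigma), cycle_of_type sigma S' &
    forall u v : R, 0 < v ->
      let w := u *: e1 sigma + v *: e2 sigma in
      mobius_defined sigma g w -> (S w <-> S' (mobius sigma g w)).
Proof.
have [L -> hL] := cycle_locus_or_null_line _ _ _ hsigma hS.
suff [L' hL' LL'] : exists2 L' : set (R * R),
    cycle_of_type sigma (image L' (vect sigma)) &
    forall p, mobius_norm sigma g p != 0 -> L p <-> L' (mobius_pt sigma g p).
  exists (image L' (vect sigma)) => // u v _ w hw.
  have -> : w = vect sigma (u, v) by [].
  rewrite mobius_ptE // !vect_imageE.
  exact/LL'/mobius_norm_neq0.
case: hL => [[K [l [n [M [hnd ->]]]]]|[eps [s [heps ->]]]].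
  have [K' [L' [n' [M' [hnd' h]]]]] := locus_mobius _ _ _ _ _ _ _ hg hnd.
  by exists (locus sigma K' L' n' M') => //; apply: cycle_locus.
have [s' h] := null_line_mobius _ _ _ s _ hg heps.
by exists (null_line eps s') => //; apply: cycle_null_line.
Qed.
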